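(* Let $n\ge 4$ be even, $k=n/2$, and let $G=(V,E)$ be a graph with vertex set $V=\{1,\dots,n\}$, with graph state $|G\rangle$ and stabilizer operators $g_1,\dots,g_n$. Let $T>0$ be an arbitrary (unknown) temperature, $\beta=1/(k_BT)$, and let $\rho_T$ be the $n$-qubit thermal graph state at temperature $T$. Let $0<\epsilon,\delta<1$ and $N=\lceil (2/\epsilon^2)\log(2/\delta)\rceil$. Suppose the observable $S_{1^k0^k}=g_1g_2\cdots g_k$ is measured on each of $N$ independent copies of $\rho_T$, producing outcomes $o_1,\dots,o_N\in\{+1,-1\}$, and set $F_{\rm est}=\frac{1}{N}\sum_{i=1}^N o_i$. Then, with probability at least $1-\delta$, $$\left|\langle G|\rho_T|G\rangle-F_{\rm est}\right|\le \frac{n e^{-4\beta}}{2(1+e^{-2\beta})^n}+\epsilon\le \frac{2}{n}+\epsilon .$$ Moreover, in the limit $N\to\infty$, the inequality $\langle G|\rho_T|G\rangle\ge F_{\rm est}$ holds with probability one.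
   Context: For a graph $G=(V,E)$ on $n$ vertices, the graph state is $|G\rangle=\left(\prod_{(i,j)\in E}CZ_{i,j}\right)|+\rangle^{\otimes n}$, where $|+\rangle=(|0\rangle+|1\rangle)/\sqrt2$ and $CZ_{i,j}$ is the controlled-$Z$ gate on qubits $i,j$. Its stabilizer operators are $g_i=X_i\prod_{j:(i,j)\in E}Z_j$ for $1\le i\le n$, where $X_i,Z_j$ are Pauli operators on the indicated qubits. For $\ell=\ell_1\cdots\ell_n\in\{0,1\}^n$ let $S_\ell=\prod_{i=1}^n g_i^{\ell_i}$; $1^k0^k$ denotes the string of $k$ ones followed by $k$ zeros. Measuring $S_\ell$ on a state $\rho$ means performing the two-outcome projective measurement onto its $\pm1$ eigenspaces, so the outcome has expectation ${\rm Tr}[\rho S_\ell]$. With $\mathcal H=-\sum_{i=1}^n g_i$, the thermal graph state at temperature $T>0$ is $\rho_T=e^{-\beta\mathcal H}/{\rm Tr}[e^{-\beta\mathcal H}]$ with $\beta=1/(k_BT)$, $k_B$ the Boltzmann constant. $\log$ denotes the natural logarithm and $\lceil\cdot\rceil$ the ceiling function. *)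

(* Defs.v *)
From HB Require Import structures.
From mathcomp Require Import all_boot all_order all_algebra.
From mathcomp Require Import all_classical all_reals all_analysis.
Set Implicit Arguments. Unset Strict Implicit. Unset Printing Implicit Defensive.
Import Order.TTheory GRing.Theory Num.Theory.
Import numFieldNormedType.Exports.
Local Open Scope classical_set_scope.
Local Open Scope ring_scope.

Section QubitDefs.
Variables (R : realType) (n : nat).

(* Computational basis of n qubits: basis index a : 'I_(2^n); bit of qubit i. *)
Definition qbit (a : 'I_(2 ^ n)) (i : 'I_n) : bool := odd (a %/ 2 ^ i).

(* Pauli X on qubit i (I (x) .. (x) X (x) .. (x) I) in the computational basis. *)
Definition Xop (i : 'I_n) : 'M[R]_(2 ^ n) :=
  \matrix_(a, b) (if [forall j, (qbit a j == qbit b j) == (j != i)] then 1 else 0).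

Definition Zop (i : 'I_n) : 'M[R]_(2 ^ n) :=
  \matrix_(a, b) (if a == b then (-1) ^+ qbit a i else 0).

Definition CZop (i j : 'I_n) : 'M[R]_(2 ^ n) :=
  \matrix_(a, b) (if a == b then (-1) ^+ (qbit a i && qbit a j) else 0).

Definition plus_state : 'cV[R]_(2 ^ n) := const_mx ((Num.sqrt 2)^-1 ^+ n).

Definition edges (e : rel 'I_n) : seq ('I_n * 'I_n) :=
  [seq p <- [seq (i, j) : 'I_n * 'I_n | i <- enum 'I_n, j <- enum 'I_n] | (val p.1 < val p.2)%N && e p.1 p.2].

Definition graph_state (e : rel 'I_n) : 'cV[R]_(2 ^ n) :=
  foldr (fun p v => CZop p.1 p.2 *m v) plus_state (edges e).

Definition stab (e : rel 'I_n) (i : 'I_n) : 'M[R]_(2 ^ n) :=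
  Xop i *m foldr (fun j M => Zop j *m M) 1%:M [seq j <- enum 'I_n | e i j].

Definition S_ell (e : rel 'I_n) (l : 'I_n -> bool) : 'M[R]_(2 ^ n) :=
  foldr (fun i M => (if l i then stab e i else 1%:M) *m M) 1%:M (enum 'I_n).

Definition ell_half (i : 'I_n) : bool := (i < n./2)%N.

Definition Hgraph (e : rel 'I_n) : 'M[R]_(2 ^ n) := - \sum_(i < n) stab e i.

End QubitDefs.

Definition mxpow (R : realType) (m : nat) (A : 'M[R]_m) (k : nat) : 'M[R]_m :=
  iter k (mulmx A) 1%:M.

Definition expm (R : realType) (m : nat) (A : 'M[R]_m) : 'M[R]_m :=
  \matrix_(i, j) limn (fun N : nat => ((\sum_(k < N) (k`!%:R)^-1 *: mxpow A k) i j : R)).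

Definition thermal_state (R : realType) (n : nat) (e : rel 'I_n) (kB T : R)
  : 'M[R]_(2 ^ n) :=
  let beta := 1 / (kB * T) in
  let E := expm ((- beta) *: Hgraph R e) in
  (\tr E)^-1 *: E.

Definition fidelity (R : realType) (n : nat) (e : rel 'I_n) (rho : 'M[R]_(2 ^ n)) : R :=
  ((graph_state R e)^T *m rho *m graph_state R e) 0 0.

(* Born rule for the two-outcome projective measurement of an observable S
   with S^2 = 1: projectors onto the +1 / -1 eigenspaces are (1 +- S)/2.
   Outcome true = +1, false = -1. *)
Definition born (R : realType) (m : nat) (rho S : 'M[R]_m) (b : bool) : R :=
  \tr (rho *m ((2 : R)^-1 *: (1%:M + (if b then S else - S)))).

(* Probability of an event about the outcomes of measuring S on each of N
   independent copies of rho (i.e. on rho^{(x) N}). *)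
Definition event_prob (R : realType) (m : nat) (rho S : 'M[R]_m) (N : nat)
  (P : pred {ffun 'I_N -> bool}) : R :=
  \sum_(o : {ffun 'I_N -> bool} | P o) \prod_(i < N) born rho S (o i).

Definition Fest (R : realType) (N : nat) (o : {ffun 'I_N -> bool}) : R :=
  (N%:R)^-1 * \sum_(i < N) (if o i then 1 else -1).

(* Main.v *)
(** The vectors Z^s|G>, s in {0,1}^n, form an orthonormal basis in which g_i acts
    as (-1)^{s_i}.  So exp(-beta H), S_l and rho_T are diagonal there, and sums over
    s of products over qubits factorise.  With q = e^{-2 beta} this gives
      F = <G|rho_T|G> = 1 / (1 + q)^n,
      m = Tr[rho_T g_1 ... g_k] = (1 - q^2)^k / (1 + q)^n.
    Bernoulli's inequality yields 0 < F - m <= k q^2 / (1 + q)^n, the systematic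
    error, and (1 + q)^k >= 1 + k q bounds the latter by 2/n.  The statistical error
    is controlled by Hoeffding's inequality for +1/-1 outcomes; since the gap F - m
    is strictly positive, the event F_est > F is exponentially unlikely in the
    number of samples. *)
Require Import Defs.
From HB Require Import structures.
From mathcomp Require Import all_boot all_order all_algebra.
From mathcomp Require Import all_classical all_reals all_analysis.
From mathcomp Require Import ring lra.
Set Implicit Arguments. Unset Strict Implicit. Unset Printing Implicit Defensive.
Import Order.TTheory GRing.Theory Num.Theory.
Import numFieldNormedType.Exports.
Local Open Scope classical_set_scope.
Local Open Scope ring_scope.

(** * Basis indices as bit strings *)

Lemma eq_odd_div2X (n a b : nat) : (a < 2 ^ n)%N -> (b < 2 ^ n)%N ->
  (forall i, (i < n)%N -> odd (a %/ 2 ^ i) = odd (b %/ 2 ^ i)) -> a = b.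
Proof.
elim: n a b => [|n IH] a b.
  by rewrite expn0 !ltnS !leqn0 => /eqP-> /eqP->.
move=> ha hb h.
have h0 : odd a = odd b by have := h 0 (ltn0Sn n); rewrite !divn1.
rewrite -(odd_double_half a) -(odd_double_half b) h0; congr (_ + _.*2)%N.
apply: IH; rewrite ?ltn_half_double -?mul2n -?expnS //.
by move=> i hi; rewrite -!divn2 -!divnMA -!expnS h.
Qed.

Lemma qbit_inj (n : nat) (a b : 'I_(2 ^ n)) : qbit a =1 qbit b -> a = b.
Proof.
move=> h; apply: val_inj; apply: (@eq_odd_div2X n) => [||i hi].
- exact: ltn_ord.
- exact: ltn_ord.
- exact: (h (Ordinal hi)).
Qed.

Lemma bij_qbit (n : nat) :
  bijective (fun a : 'I_(2 ^ n) => [ffun i => qbit a i]).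
Proof.
apply: inj_card_bij; last by rewrite card_ffun card_bool !card_ord.
by move=> a b /ffunP h; apply: qbit_inj => i; have := h i; rewrite !ffunE.
Qed.

Lemma qbit_surj (n : nat) (x : 'I_n -> bool) :
  exists a : 'I_(2 ^ n), qbit a =1 x.
Proof.
have [g _ gK] := bij_qbit n; exists (g [ffun i => x i]) => i.
by have /ffunP/(_ i) := gK [ffun i => x i]; rewrite !ffunE.
Qed.

(** Distributivity, after reindexing basis indices by bit strings. Every trace and inner product
    below factorises over the qubits through it. *)
Lemma sum_prod_qbit (R : realType) (n : nat) (F : 'I_n -> bool -> R) :
  \sum_(a < 2 ^ n) \prod_i F i (qbit a i) = \prod_i (F i true + F i false).
Proof.
rewrite (eq_bigr (fun i => \sum_b F i b)); last by move=> i _; rewrite big_bool.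
rewrite bigA_distr_bigA [RHS](reindex _ (onW_bij _ (bij_qbit n))) /=.
by apply: eq_bigr => a _; apply: eq_bigr => i _; rewrite ffunE.
Qed.

(** * The graph basis *)

(* The computational-basis amplitudes of |G> are 2^{-n/2} edge_sign. *)
Definition edge_sign (R : realType) (n : nat) (e : rel 'I_n) (x : 'I_n -> bool) : R :=
  \prod_(i < n) \prod_(j < n | (i < j)%N && e i j) (-1) ^+ (x i && x j).

(** Only edges at [i] are affected, and flipping [x i] changes the exponent [x i && x j] exactly
    when [x j] holds. This is the phase from commuting X_i past the CZ gates. *)
Lemma edge_sign_flip (R : realType) (n : nat) (e : rel 'I_n)
    (e_sym : symmetric e) (e_irr : irreflexive e) (i : 'I_n) (x y : 'I_n -> bool) :
  (forall j, (x j == y j) = (j != i)) ->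
  edge_sign R e y = edge_sign R e x * \prod_(j | e i j) (-1) ^+ x j.
Proof.
move=> xy.
have yi : y i = ~~ x i.
  by have := xy i; rewrite eqxx; case: (x i) (y i) => [] [].
have yj j : j != i -> y j = x j by move=> ji; have := xy j; rewrite ji => /eqP.
(* [edge_sign] lists each edge once, smaller endpoint first, so the neighbours of [i] are split by
   side. Each half is then spread over all ordered edges, and the identity is checked factor by
   factor. *)
rewrite [X in _ * X](bigID (fun j : 'I_n => i < j)%N) /=.
have -> : \prod_(j | e i j && (i < j)%N) (-1) ^+ x j =
    \prod_(p < n) \prod_(q < n | (p < q)%N && e p q) (if p == i then (-1) ^+ x q else 1) :> R.
  rewrite [RHS](bigD1 i) //= [X in _ = _ * X]big1 ?mulr1; last first.
    by move=> p /negPf ->; rewrite big1.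
  by rewrite eqxx; apply: eq_bigl => j; rewrite andbC.
have -> : \prod_(j | e i j && ~~ (i < j)%N) (-1) ^+ x j =
    \prod_(p < n) \prod_(q < n | (p < q)%N && e p q) (if q == i then (-1) ^+ x p else 1) :> R.
  rewrite [RHS](exchange_big_dep predT) //= [RHS](bigD1 i) //= [X in _ = _ * X]big1 ?mulr1; last first.
    by move=> p /negPf ->; rewrite big1.
  rewrite eqxx; apply: eq_bigl => j; rewrite e_sym andbC -leqNgt.
  by case: ltngtP => // /val_inj ->; rewrite e_irr.
rewrite -!big_split /=; apply: eq_bigr => p _.
rewrite -!big_split /=; apply: eq_bigr => q /andP[pq _].
case: (eqVneq p i) => [pi|pi].
  have qi : q != i by rewrite -pi; apply: contraTneq pq => ->; rewrite ltnn.
  rewrite (negPf qi) mulr1 pi yi (yj _ qi).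
  by case: (x i) (x q) => [] []; rewrite /= ?expr0 ?expr1; ring.
case: (eqVneq q i) => [qi|qi]; last by rewrite !yj // !mulr1.
rewrite mul1r qi yi (yj _ pi).
by case: (x i) (x p) => [] []; rewrite /= ?expr0 ?expr1; ring.
Qed.

(* Column s is Z^s|G>. *)
Definition graph_basis (R : realType) (n : nat) (e : rel 'I_n) : 'M[R]_(2 ^ n) :=
  \matrix_(a, s) (edge_sign R e (qbit a) *
    \prod_i ((Num.sqrt 2)^-1 * (-1) ^+ (qbit a i && qbit s i))).

Lemma edge_sign_sqr (R : realType) (n : nat) (e : rel 'I_n) x :
  edge_sign R e x * edge_sign R e x = 1.
Proof.
rewrite -big_split big1 //= => i _; rewrite -big_split big1 //= => j _.
by rewrite -expr2 sqrr_sign.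
Qed.

(** The edge signs square to 1, which leaves a Hadamard matrix; a qubit where [s] and [t] differ
    contributes the factor 1/2 - 1/2 = 0. *)
Lemma graph_basis_orthogonal (R : realType) (n : nat) (e : rel 'I_n) :
  (graph_basis R e)^T *m graph_basis R e = 1%:M.
Proof.
apply/matrixP => s t; rewrite !mxE.
pose F i b : R := 2^-1 * (-1) ^+ ((b && qbit s i) (+) (b && qbit t i)).
rewrite (eq_bigr (fun a => \prod_i F i (qbit a i))); last first.
  move=> a _; rewrite !mxE mulrACA edge_sign_sqr mul1r -big_split /=.
  apply: eq_bigr => i _; rewrite mulrACA -signr_addb /F; congr (_ * _).
  by rewrite -invfM -expr2 sqr_sqrtr // ler0n.
rewrite sum_prod_qbit /F /=.
case: (eqVneq s t) => [->|st].
  by rewrite big1 // => i _; rewrite addbb /= expr0; lra.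
have /existsP[i hi] : [exists i, qbit s i != qbit t i].
  apply: contraR st; rewrite negb_exists => /forallP h.
  by apply/eqP/qbit_inj => i; apply/eqP; have := h i; rewrite negbK.
rewrite (bigD1 i) //= (_ : _ + _ = 0) ?mul0r //.
by move: hi; case: (qbit s i) (qbit t i) => [] [] //= _; rewrite ?expr0 ?expr1; lra.
Qed.

Lemma graph_stateE (R : realType) (n : nat) (e : rel 'I_n) a :
  graph_state R e a 0 = edge_sign R e (qbit a) * (Num.sqrt 2)^-1 ^+ n.
Proof.
have -> : edge_sign R e (qbit a) =
    \prod_(p <- edges e) (-1) ^+ (qbit a p.1 && qbit a p.2).
  rewrite /edges big_filter big_mkcond big_allpairs big_enum /=.
  by apply: eq_bigr => i _; rewrite big_mkcond big_enum.
rewrite /graph_state; elim: (edges e) => [|p l IH] /=.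
  by rewrite big_nil mul1r mxE.
rewrite mxE (bigD1 a) //= big1 ?addr0; last first.
  by move=> b; rewrite mxE eq_sym => /negPf ->; rewrite mul0r.
by rewrite mxE eqxx IH big_cons mulrA.
Qed.

Lemma graph_state_col (R : realType) (n : nat) (e : rel 'I_n) (s : 'I_(2 ^ n)) :
  (forall i, qbit s i = false) -> graph_state R e = col s (graph_basis R e).
Proof.
move=> s0; apply/matrixP => a j; rewrite ord1 graph_stateE !mxE; congr (_ * _).
under eq_bigr do rewrite s0 andbF expr0 mulr1.
by rewrite prodr_const card_ord.
Qed.

(** * Stabilizer operators in the graph basis *)

Lemma prod_ZopE (R : realType) (n : nat) (l : seq 'I_n) :
  foldr (fun j M => Zop R j *m M) 1%:M l =
  diag_mx (\row_a \prod_(j <- l) (-1) ^+ qbit a j).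
Proof.
elim: l => [|j l IH] /=.
  by rewrite -diag_const_mx; congr diag_mx; apply/rowP => a; rewrite !mxE big_nil.
rewrite IH (_ : Zop R j = diag_mx (\row_a (-1) ^+ qbit a j)).
  rewrite mulmx_diag; congr diag_mx; apply/rowP => a.
  by rewrite !mxE big_cons.
by apply/matrixP => a b; rewrite !mxE; case: eqP.
Qed.

Lemma Xop_mulE (R : realType) (n p : nat) (i : 'I_n) (M : 'M[R]_(2 ^ n, p)) a b c :
  (forall j, (qbit a j == qbit b j) = (j != i)) -> (Xop R i *m M) a c = M b c.
Proof.
move=> ab; rewrite mxE (bigD1 b) //= big1 ?addr0 => [|d db].
  rewrite mxE ifT ?mul1r //; apply/forallP => j; apply/eqP; exact: ab.
rewrite mxE ifF ?mul0r //; apply: contraNF db => /forallP ad.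
apply/eqP/qbit_inj => j; have := ab j; rewrite -(eqP (ad j)).
by case: (qbit a j) (qbit b j) (qbit d j) => [] [] [].
Qed.

(** X_i flips bit [i] of the row index. The resulting change of edge sign cancels the Z factors of
    g_i, and the flip inside Z^s leaves (-1)^{s_i}. *)
Lemma stab_graph_basis (R : realType) (n : nat) (e : rel 'I_n)
    (e_sym : symmetric e) (e_irr : irreflexive e) (i : 'I_n) :
  stab R e i *m graph_basis R e =
  graph_basis R e *m diag_mx (\row_s (-1) ^+ qbit s i).
Proof.
apply/matrixP => a s; rewrite /stab prod_ZopE -mulmxA.
have [b hb] := qbit_surj (fun j => if j == i then ~~ qbit a j else qbit a j).
have ab j : (qbit a j == qbit b j) = (j != i).
  by rewrite hb; case: (eqVneq j i); rewrite ?eqxx //; case: (qbit a j).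
rewrite (Xop_mulE _ _ ab) mul_diag_mx mul_mx_diag !mxE.
have ba j : (qbit b j == qbit a j) = (j != i) by rewrite eq_sym.
have sgn_e : \prod_(j <- [seq j <- enum 'I_n | e i j]) (-1) ^+ qbit b j =
    \prod_(j | e i j) (-1) ^+ qbit b j :> R.
  by rewrite big_filter big_mkcond big_enum -big_mkcond.
have sgn_s : \prod_j ((Num.sqrt 2)^-1 * (-1) ^+ (qbit b j && qbit s j)) =
    (\prod_j ((Num.sqrt 2)^-1 * (-1) ^+ (qbit a j && qbit s j))) * (-1) ^+ qbit s i :> R.
  rewrite [LHS](bigD1 i) //= [X in _ = X * _](bigD1 i) //= [RHS]mulrAC.
  congr (_ * _); first rewrite hb eqxx.
    by case: (qbit a i) (qbit s i) => [] [] /=; rewrite ?expr0 ?expr1; ring.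
  by apply: eq_bigr => j /negPf ji; rewrite hb ji.
by rewrite sgn_e sgn_s (edge_sign_flip R e_sym e_irr ba); ring.
Qed.

(** * Matrix exponential and products in an eigenbasis *)

Lemma expm_orthogonal_diag (R : realType) (m : nat) (U : 'M[R]_m) (d : 'rV[R]_m) :
  U^T *m U = 1%:M ->
  expm (U *m diag_mx d *m U^T) = U *m diag_mx (map_mx expR d) *m U^T.
Proof.
move=> UU.
have powE k : mxpow (U *m diag_mx d *m U^T) k =
    U *m diag_mx (map_mx (fun x => x ^+ k) d) *m U^T.
  elim: k => [|k IH].
    have -> : map_mx (fun x : R => x ^+ 0) d = const_mx 1.
      by apply/rowP => j; rewrite !mxE expr0.
    by rewrite diag_const_mx mulmx1 /= mulmx1C.
  rewrite /mxpow iterS -/(mxpow _ k) IH -!mulmxA; congr (_ *m _).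
  rewrite (mulmxA U^T U) UU mul1mx !mulmxA mulmx_diag; congr (diag_mx _ *m _).
  by apply/rowP => j; rewrite !mxE exprS.
have entryE (f : 'rV[R]_m) i j : (U *m diag_mx f *m U^T) i j = \sum_s U i s * U j s * f 0 s.
  rewrite !mxE; apply: eq_bigr => s _.
  by rewrite mul_mx_diag !mxE mulrAC.
apply/matrixP => i j; rewrite mxE entryE; apply/cvg_lim => //.
(* Entrywise, a partial sum is a finite combination of partial sums of the scalar exponential
   series, so convergence is inherited from these. *)
have -> : (fun N => (\sum_(k < N) (k`!%:R)^-1 *: mxpow (U *m diag_mx d *m U^T) k) i j) =
    (fun N => \sum_s U i s * U j s * series (exp_coeff (d 0 s)) N).
  apply/funext => N; rewrite summxE.
  under eq_bigr do rewrite mxE powE entryE mulr_sumr.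
  rewrite exchange_big /=; apply: eq_bigr => s _.
  rewrite /series /= big_mkord mulr_sumr; apply: eq_bigr => k _.
  by rewrite !mxE /exp_coeff /=; ring.
apply: cvg_big => [|s _]; first exact: add_continuous.
by rewrite mxE; apply: cvgMl_tmp; exact: is_cvg_series_exp_coeff.
Qed.

(** The form A U = U D, without U^T, composes directly under products. *)
Lemma mxdiag_intertwine_mul (R : realType) (m : nat) (U A B : 'M[R]_m) (a b : 'rV[R]_m) :
  A *m U = U *m diag_mx a -> B *m U = U *m diag_mx b ->
  A *m B *m U = U *m diag_mx (\row_j (a 0 j * b 0 j)).
Proof. by move=> hA hB; rewrite -mulmxA hB mulmxA hA -mulmxA mulmx_diag. Qed.

(** * Diagonalization in the graph basis *)

Section GraphBasisDiagonalization.
Variables (R : realType) (n : nat) (e : rel 'I_n).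
Hypotheses (e_sym : symmetric e) (e_irr : irreflexive e).
Let U := graph_basis R e.
Let sgn (s : 'I_(2 ^ n)) (i : 'I_n) : R := (-1) ^+ qbit s i.

Lemma S_ell_graph_basis (l : 'I_n -> bool) :
  S_ell R e l *m U = U *m diag_mx (\row_s \prod_(i | l i) sgn s i).
Proof.
rewrite /S_ell.
have -> : \row_s \prod_(i | l i) sgn s i = \row_s \prod_(i <- enum 'I_n | l i) sgn s i.
  by apply/rowP => s; rewrite !mxE big_enum_cond.
elim: (enum _) => [|i r IH] /=.
  rewrite mul1mx (_ : \row__ _ = const_mx 1) ?diag_const_mx ?mulmx1 //.
  by apply/rowP => s; rewrite !mxE big_nil.
case: ifP => li.
  rewrite (mxdiag_intertwine_mul (stab_graph_basis R e_sym e_irr i) IH).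
  by congr (_ *m diag_mx _); apply/rowP => s; rewrite !mxE big_cons li.
rewrite mul1mx IH.
by congr (_ *m diag_mx _); apply/rowP => s; rewrite !mxE big_cons li.
Qed.

(** The eigenvalue exp(b * sum_i (-1)^{s_i}) is written as a product over qubits, ready for
    [sum_prod_qbit]. *)
Lemma expm_Hgraph_graph_basis (b : R) :
  expm ((- b) *: Hgraph R e) *m U =
  U *m diag_mx (\row_s \prod_i expR (b * sgn s i)).
Proof.
have UU : U^T *m U = 1%:M := graph_basis_orthogonal R e.
have -> : (- b) *: Hgraph R e = U *m diag_mx (\row_s (b * \sum_i sgn s i)) *m U^T.
  have <- : b *: (\sum_i stab R e i) *m U = U *m diag_mx (\row_s (b * \sum_i sgn s i)).
    rewrite -scalemxAl mulmx_suml; under eq_bigr do rewrite stab_graph_basis //.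
    rewrite -mulmx_sumr scalemxAr; congr (_ *m _).
    apply/matrixP => s t; rewrite !mxE summxE; under [X in _ * X]eq_bigr do rewrite !mxE.
    by case: eqP => // _; rewrite !mulr0n big1 ?mulr0.
  by rewrite -mulmxA (mulmx1C UU) mulmx1 /Hgraph scaleNr scalerN opprK.
rewrite expm_orthogonal_diag // -mulmxA UU mulmx1; congr (_ *m diag_mx _).
by apply/rowP => s; rewrite !mxE mulr_sumr expR_sum.
Qed.

Lemma trace_graph_basis (A : 'M[R]_(2 ^ n)) (d : 'rV[R]_(2 ^ n)) :
  A *m U = U *m diag_mx d -> \tr A = \sum_s d 0 s.
Proof.
move=> AU; have UU : U^T *m U = 1%:M := graph_basis_orthogonal R e.
by rewrite -[A]mulmx1 -(mulmx1C UU) mulmxA AU mxtrace_mulC mulmxA UU mul1mx mxtrace_diag.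
Qed.

Lemma trace_expm_Hgraph (b : R) :
  \tr (expm ((- b) *: Hgraph R e)) = (expR b + expR (- b)) ^+ n.
Proof.
rewrite (trace_graph_basis (expm_Hgraph_graph_basis b)).
under eq_bigr do rewrite mxE.
rewrite (sum_prod_qbit (fun _ x => expR (b * (-1) ^+ x))) /= expr0 expr1 mulr1 mulrN1.
by rewrite prodr_const card_ord addrC.
Qed.

(** The extra sign (-1)^{s_i} on qubits in [l] turns their factor from a sum of exponentials into a
    difference. *)
Lemma trace_expm_Hgraph_S_ell (b : R) (l : 'I_n -> bool) :
  \tr (expm ((- b) *: Hgraph R e) *m S_ell R e l) =
  (expR b - expR (- b)) ^+ #|l| * (expR b + expR (- b)) ^+ #|predC l|.
Proof.
rewrite (trace_graph_basis (mxdiag_intertwine_mul (expm_Hgraph_graph_basis b) (S_ell_graph_basis l))).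
under eq_bigr do rewrite !mxE (big_mkcond l) -big_split /=.
rewrite (sum_prod_qbit (fun i x => expR (b * (-1) ^+ x) * (if l i then (-1) ^+ x else 1))) /=.
rewrite (bigID l) /= expr0 expr1 !mulr1 mulrN1; congr (_ * _).
  rewrite -prodr_const; apply: eq_bigr => i li; rewrite (_ : l i) //.
  by rewrite mulr1 mulrN1 addrC.
rewrite -prodr_const; apply: eq_bigr => i /negPf li; rewrite (_ : l i = false) //.
by rewrite !mulr1 addrC.
Qed.

(** |G> is the column s = 0, where every g_i has eigenvalue +1. *)
Lemma expm_Hgraph_graph_state (b : R) :
  ((graph_state R e)^T *m expm ((- b) *: Hgraph R e) *m graph_state R e) 0 0 = expR b ^+ n.
Proof.
have [s hs] := qbit_surj (fun _ : 'I_n => false).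
rewrite (graph_state_col R e hs) -mulmxA.
have -> A : A *m col s (graph_basis R e) = col s (A *m U) by rewrite !colE mulmxA.
rewrite expm_Hgraph_graph_basis.
have -> M : (col s (graph_basis R e))^T *m col s M = \matrix_(_, _) (U^T *m M) s s.
  by apply/matrixP => i j; rewrite !mxE; apply: eq_bigr => a _; rewrite !mxE.
rewrite mulmxA graph_basis_orthogonal mul1mx !mxE eqxx mulr1n.
rewrite (eq_bigr (fun=> expR b)); first by rewrite prodr_const card_ord.
by move=> i _; rewrite /sgn hs expr0 mulr1.
Qed.
End GraphBasisDiagonalization.

(** * Hoeffding's inequality for two-valued outcomes *)

Lemma is_derive_ge0_le (R : realType) (f df : R -> R) (x : R) : 0 <= x ->
  (forall t : R, is_derive t (1 : R) f (df t)) -> (forall t, 0 <= t -> 0 <= df t) ->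
  f 0 <= f x.
Proof.
move=> x0 fdf df0.
have fc : {within `[0, x], continuous f}.
  apply: continuous_subspaceT => t; apply: differentiable_continuous.
  by apply/derivable1_diffP; have [] := fdf t.
have [c c0x] := MVT_segment x0 (fun t _ => fdf t) fc.
rewrite subr0 => fE; rewrite -subr_ge0 fE mulr_ge0 ?df0 //.
by rewrite (itvP c0x).
Qed.

(** The left side [D l] is the moment generating function of a +1/-1 outcome of mean [m]. Since D''
    = D, the second derivative of ln D is 1 - (D'/D)^2 <= 1; integrating twice from 0 gives the
    bound. *)
Lemma hoeffding_two_point_nneg (R : realType) (m l : R) : -1 <= m <= 1 -> 0 <= l ->
  (1 + m) / 2 * expR l + (1 - m) / 2 * expR (- l) <= expR (m * l + l ^+ 2 / 2).
Proof.
move=> /andP[m0 m1] l0.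
pose D (t : R) := (1 + m) / 2 * expR t + (1 - m) / 2 * expR (- t).
pose D' (t : R) := (1 + m) / 2 * expR t - (1 - m) / 2 * expR (- t).
have dD (t : R) : is_derive t (1 : R) D (D' t).
  by rewrite /D; apply: is_derive_eq; rewrite /D' /GRing.scale /=; ring.
have dD' (t : R) : is_derive t (1 : R) D' (D t).
  by rewrite /D'; apply: is_derive_eq; rewrite /D /GRing.scale /=; ring.
have Dgt0 t : 0 < D t.
  have := expR_gt0 t; have := expR_gt0 (- t); rewrite /D; nra.
have is_deriveV (t : R) :
    is_derive t (1 : R) (fun y => (D y)^-1) (- (D' t / D t ^+ 2)).
  have [? <-] := dD t.
  apply: DeriveDef; first by apply: derivableV; rewrite ?gt_eqF.
  by rewrite deriveV ?gt_eqF // /GRing.scale /= mulNr mulrC.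
(* G is the derivative of t |-> m t + t^2/2 - ln (D t), and G' = (D'/D)^2. *)
pose G (t : R) := m + t - D' t * (D t)^-1.
have G_ge0 t : 0 <= t -> 0 <= G t.
  move=> t0; have -> : 0 = G 0 by rewrite /G /D' /D oppr0 expR0; field; lra.
  apply: (@is_derive_ge0_le _ G (fun t => (D' t / D t) ^+ 2)) => // [{t0}t|u _].
    rewrite /G; apply: is_derive_eq; rewrite /GRing.scale /=.
    by have := Dgt0 t => ?; field; lra.
  exact: sqr_ge0.
(* Exponentiating the comparison avoids the logarithm: h' is a positive factor times [G], and
   [h 0 = -1]. *)
pose h (t : R) := - (expR (- (m * t + t * t / 2)) * D t).
have : h 0 <= h l.
  apply: (@is_derive_ge0_le _ h
    (fun t => expR (- (m * t + t * t / 2)) * D t * G t)) => // t => [|t0].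
    rewrite /h; apply: is_derive_eq; rewrite /GRing.scale /= /G.
    by have := Dgt0 t => ?; field; lra.
  by rewrite !mulr_ge0 ?expR_ge0 ?G_ge0 // ltW.
have D0 : D 0 = 1 by rewrite /D oppr0 expR0; field.
rewrite /h D0 !mulr0 mul0r addr0 oppr0 expR0 mulr1 lerN2 expRN.
by move=> hl; rewrite -[leRHS]mulr1 -ler_pdivrMl ?expR_gt0 // expr2.
Qed.

Lemma hoeffding_two_point (R : realType) (m l : R) : -1 <= m <= 1 ->
  (1 + m) / 2 * expR (l * (1 - m)) + (1 - m) / 2 * expR (l * (-1 - m)) <= expR (l ^+ 2 / 2).
Proof.
move=> hm.
have -> : l * (1 - m) = l - m * l by ring.
have -> : l * (-1 - m) = - l - m * l by ring.
rewrite !(expRD _ (- (m * l))) !mulrA -mulrDl [expR (- (m * l))]expRN ler_pdivrMr ?expR_gt0 //.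
rewrite -expRD [l ^+ 2 / 2 + _]addrC.
have [l0|l0] := leP 0 l; first exact: hoeffding_two_point_nneg.
(* For negative [l], exchanging the two outcomes replaces (m, l) by (-m, -l). *)
have hm' : -1 <= - m <= 1 by lra.
have := @hoeffding_two_point_nneg _ (- m) (- l) hm'.
rewrite opprK sqrrN mulrNN oppr_ge0 ltW // => /(_ isT).
by rewrite opprK [X in X <= _ -> _]addrC.
Qed.

Definition outcome (R : realType) (b : bool) : R := if b then 1 else -1.

(* Both tails are covered: a negative l gives the lower one. *)
Lemma hoeffding_tail (R : realType) (m l : R) (N : nat) (P : pred {ffun 'I_N -> bool}) :
  -1 <= m <= 1 ->
  (forall o, P o -> N%:R * l ^+ 2 <= l * \sum_(i < N) (outcome R (o i) - m)) ->
  \sum_(o | P o) \prod_(i < N) ((1 + m * outcome R (o i)) / 2) <=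
    expR (- (N%:R * (l ^+ 2 / 2))).
Proof.
move=> hm hP.
pose w b := (1 + m * outcome R b) / 2.
have w0 b : 0 <= w b by rewrite /w /outcome; case: b; lra.
(* Exponential Markov bound: on [P] the hypothesis makes the total exponent of the tilted weights
   nonnegative, so they dominate the original ones there. *)
pose F b := w b * expR (l * (outcome R b - m) - l ^+ 2).
apply: (@le_trans _ _ (\sum_(o : {ffun 'I_N -> bool}) \prod_(i < N) F (o i))).
  rewrite [leRHS](bigID P) /= -[leLHS]addr0 lerD //; last first.
    by apply: sumr_ge0 => o _; apply: prodr_ge0 => i _; rewrite mulr_ge0 ?expR_ge0.
  apply: ler_sum => o /hP ho; rewrite [leRHS]big_split /=.
  apply: ler_peMr; first by apply: prodr_ge0 => i _; exact: w0.
  rewrite -expR_sum -{1}expR0 ler_expR sumrB -mulr_sumr sumr_const card_ord.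
  by rewrite -mulr_natl subr_ge0.
(* By independence the tilted sum is an N-th power; each factor is at most exp(l^2/2 - l^2). *)
rewrite -(bigA_distr_bigA (fun _ : 'I_N => F)) prodr_const card_ord.
rewrite -mulrN expRM_natl lerXn2r ?nnegrE ?expR_ge0 //.
  by apply: sumr_ge0 => b _; rewrite mulr_ge0 ?expR_ge0.
rewrite big_bool /F /w /outcome /= !expRB !mulrA -mulrDl.
rewrite ler_pdivrMr ?expR_gt0 // -expRD.
have -> : - (l ^+ 2 / 2) + l ^+ 2 = l ^+ 2 / 2 by field.
by have := hoeffding_two_point l hm; rewrite mulr1 mulrN1 [_ / 2 * _]mulrC.
Qed.

Lemma bernoulli_ineq (R : realDomainType) (x : R) (k : nat) :
  -1 <= x -> 1 + k%:R * x <= (1 + x) ^+ k.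
Proof.
move=> x1; elim: k => [|k IH]; first by rewrite mul0r addr0 expr0.
have k0 : 0 <= k%:R :> R by exact: ler0n.
rewrite exprS -natr1; apply: (@le_trans _ _ ((1 + x) * (1 + k%:R * x))).
  have -> : (1 + x) * (1 + k%:R * x) = 1 + (k%:R + 1) * x + k%:R * x ^+ 2 by ring.
  by rewrite lerDl mulr_ge0 ?sqr_ge0.
by rewrite ler_wpM2l //; lra.
Qed.

Lemma sum_outcomeB (R : realType) (m : R) (N : nat) (o : {ffun 'I_N -> bool}) :
  \sum_(i < N) (outcome R (o i) - m) = N%:R * (Fest R o - m).
Proof.
rewrite sumrB sumr_const card_ord mulrBr [_ * m]mulr_natl; congr (_ - _).
(* For N = 0 both sides vanish, whatever the value of the inverse of 0. *)
case: N o => [|N] o; first by rewrite big_ord0 mul0r.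
by rewrite /Fest mulrA divff ?mul1r // pnatr_eq0.
Qed.

(** * Probabilities of measurement events *)

Section MeasurementStatistics.
Variables (R : realType) (p : nat) (rho S : 'M[R]_p) (m : R).
Hypotheses (hm : -1 <= m <= 1)
  (bornE : forall b, born rho S b = (1 + m * outcome R b) / 2).

Lemma born_ge0 b : 0 <= born rho S b.
Proof. by have hm' := hm; rewrite bornE /outcome; case: b; lra. Qed.

Lemma event_prob_ge0 (N : nat) (P : pred {ffun 'I_N -> bool}) : 0 <= event_prob rho S P.
Proof.
by apply: sumr_ge0 => o _; apply: prodr_ge0 => i _; exact: born_ge0.
Qed.

(** The Born weights of one copy sum to 1, hence so do the product weights. *)
Lemma event_probC (N : nat) (P : pred {ffun 'I_N -> bool}) :
  event_prob rho S P = 1 - event_prob rho S (predC P).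
Proof.
apply/eqP; rewrite eq_sym subr_eq eq_sym; apply/eqP.
rewrite /event_prob -(bigID P predT) /=.
rewrite -(bigA_distr_bigA (fun=> born rho S)) big1 // => i _.
by rewrite big_bool !bornE /outcome /=; field.
Qed.

Lemma event_prob_subadd (N : nat) (P Q1 Q2 : pred {ffun 'I_N -> bool}) :
  (forall o, P o -> Q1 o || Q2 o) ->
  event_prob rho S P <= event_prob rho S Q1 + event_prob rho S Q2.
Proof.
move=> PQ; rewrite /event_prob (big_mkcond P) (big_mkcond Q1) (big_mkcond Q2) -big_split /=.
apply: ler_sum => o _; have w0 : 0 <= \prod_(i < N) born rho S (o i).
  by apply: prodr_ge0 => i _; exact: born_ge0.
have := PQ o; case: (P o) => [/(_ isT)|_].
  by case: (Q1 o) (Q2 o) => [] [] //= _; lra.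
by case: (Q1 o) (Q2 o) => [] []; lra.
Qed.

(** For nonzero [l], the hypothesis says that [Fest] deviates from [m] by at least |l| in the
    direction of the sign of [l]. *)
Lemma event_prob_tail (N : nat) (l : R) (P : pred {ffun 'I_N -> bool}) :
  (forall o, P o -> l ^+ 2 <= l * (Fest R o - m)) ->
  event_prob rho S P <= expR (- (N%:R * (l ^+ 2 / 2))).
Proof.
move=> hP; rewrite /event_prob; under eq_bigr do under eq_bigr do rewrite bornE.
apply: hoeffding_tail => // o /hP ho.
by rewrite sum_outcomeB [leRHS]mulrCA ler_wpM2l ?ler0n.
Qed.

End MeasurementStatistics.

Lemma card_ell_half (n : nat) : #|@ell_half n| = n./2.
Proof.
rewrite -sum1_card -(big_ord_widen n (fun=> 1%N)) ?sum1_card ?card_ord //.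
by rewrite -divn2 leq_div.
Qed.

Lemma card_predC_ell_half (n : nat) : ~~ odd n -> #|predC (@ell_half n)| = n./2.
Proof.
move=> nev; apply/eqP; rewrite -(eqn_add2l n./2) -{1}card_ell_half cardC card_ord.
by rewrite addnn even_halfK.
Qed.

(** * Thermal graph states *)

Section ThermalState.
Variables (R : realType) (n : nat) (e : rel 'I_n).
Hypotheses (e_sym : symmetric e) (e_irr : irreflexive e) (n_even : ~~ odd n).
Variables kB T : R.
Let b : R := 1 / (kB * T).
Let q : R := expR (- (2 * b)).
Let rho := thermal_state e kB T.

Let expRb_q : expR b + expR (- b) = expR b * (1 + q).
Proof. by rewrite /q mulrDr mulr1 -expRD; congr (_ + expR _); ring. Qed.

Lemma trace_thermal_state : \tr rho = 1.
Proof.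
rewrite /rho /thermal_state mxtraceZ trace_expm_Hgraph // mulVf //.
by rewrite expf_neq0 // gt_eqF // addr_gt0 ?expR_gt0.
Qed.

Lemma fidelity_thermal_state : fidelity e rho = ((1 + q) ^+ n)^-1.
Proof.
rewrite /fidelity /rho /thermal_state trace_expm_Hgraph // -scalemxAr -scalemxAl mxE.
rewrite expm_Hgraph_graph_state // expRb_q exprMn invfM mulrAC mulVf ?mul1r //.
by rewrite expf_neq0 // expR_eq0.
Qed.

(** As n = 2k, each of the k factors e^b - e^{-b} pairs with one factor e^b + e^{-b} to give
    e^{2b}(1 - q^2); the powers of e^b then cancel against the partition function. *)
Lemma trace_thermal_state_S_half :
  \tr (rho *m S_ell R e (@ell_half n)) = (1 - q ^+ 2) ^+ n./2 / (1 + q) ^+ n.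
Proof.
rewrite /rho /thermal_state -scalemxAl mxtraceZ trace_expm_Hgraph //.
rewrite trace_expm_Hgraph_S_ell // card_ell_half card_predC_ell_half //.
have -> : expR b - expR (- b) = expR b * (1 - q).
  by rewrite /q mulrBr mulr1 -expRD; congr (_ - expR _); ring.
rewrite expRb_q mulrC -exprMn.
have -> : expR b * (1 - q) * (expR b * (1 + q)) = expR b ^+ 2 * (1 - q ^+ 2) by ring.
rewrite exprMn -exprM mul2n even_halfK // exprMn invfM [expR b ^+ n * _]mulrC -mulrA.
by rewrite mulVKf // expf_neq0 // expR_eq0.
Qed.

Lemma born_thermal_state (c : bool) :
  born rho (S_ell R e (@ell_half n)) c =
  (1 + (1 - q ^+ 2) ^+ n./2 / (1 + q) ^+ n * outcome R c) / 2.
Proof.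
rewrite /born -scalemxAr mxtraceZ mulmxDr mulmx1 linearD /= trace_thermal_state.
rewrite -trace_thermal_state_S_half mulrC /outcome.
by case: c; rewrite ?mulmxN ?linearN ?mulr1 ?mulrN1.
Qed.

End ThermalState.

(** * Bounds on the systematic error *)

(** The range of [E] keeps the Born weights nonnegative, the strict gap drives the limit statement,
    and the upper bound is Bernoulli's inequality at -q^2. *)
Lemma gap_bounds (R : realFieldType) (n : nat) (q : R) :
  (4 <= n)%N -> ~~ odd n -> 0 < q < 1 ->
  let E := (1 - q ^+ 2) ^+ n./2 / (1 + q) ^+ n in
  let F := ((1 + q) ^+ n)^-1 in
  [/\ 0 <= E <= 1, 0 < F - E & F - E <= n%:R * q ^+ 2 / (2 * (1 + q) ^+ n)].
Proof.
move=> n4 nev /andP[q0 q1] E F.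
have Dge1 : 1 <= (1 + q) ^+ n by rewrite exprn_ege1 // lerDl ltW.
have Dgt0 : 0 < (1 + q) ^+ n := lt_le_trans ltr01 Dge1.
have q2 : 0 < 1 - q ^+ 2 < 1 by apply/andP; split; nra.
have k0 : n./2 != 0%N by rewrite -lt0n half_gt0; apply: leq_trans n4.
have pk : (1 - q ^+ 2) ^+ n./2 < 1 by rewrite exprn_ilt1 //; lra.
have FE : F - E = (1 - (1 - q ^+ 2) ^+ n./2) / (1 + q) ^+ n.
  by rewrite /F /E mulrBl mul1r.
split.
- rewrite divr_ge0 ?exprn_ge0 //=; [|lra..].
  by rewrite ler_pdivrMr // mul1r; lra.
- by rewrite FE divr_gt0 // subr_gt0.
- have -> : n%:R * q ^+ 2 / (2 * (1 + q) ^+ n) = n./2%:R * q ^+ 2 / (1 + q) ^+ n.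
    have -> : n%:R = n./2%:R * 2 :> R by rewrite -natrM muln2 even_halfK.
    by field; rewrite gt_eqF //= gt_eqF // ltr_wpDr.
  rewrite FE ler_pM2r ?invr_gt0 //.
  have h : 1 + n./2%:R * - q ^+ 2 <= (1 - q ^+ 2) ^+ n./2 by apply: bernoulli_ineq; lra.
  lra.
Qed.

(** With n = 2k and p = (1 + q)^k, clearing denominators reduces the claim to (kq)^2 <= p^2, and kq
    <= 1 + kq <= p. *)
Lemma bound_le (R : realFieldType) (n : nat) (q : R) :
  (0 < n)%N -> ~~ odd n -> 0 < q ->
  n%:R * q ^+ 2 / (2 * (1 + q) ^+ n) <= 2 / n%:R.
Proof.
move=> n0 nev q0.
have n0' : 0 < n%:R :> R by rewrite ltr0n.
have k0 : 0 <= n./2%:R :> R by exact: ler0n.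
have nE : n%:R = n./2%:R * 2 :> R by rewrite -natrM muln2 even_halfK.
rewrite ler_pdivrMr ?mulr_gt0 ?exprn_gt0 ?addr_gt0 //.
rewrite mulrAC ler_pdivlMr //.
have := @bernoulli_ineq _ q n./2; set p := (1 + q) ^+ n./2 => h.
have {}h : 1 + n./2%:R * q <= p by apply: h; lra.
have -> : (1 + q) ^+ n = p ^+ 2 by rewrite -exprM muln2 even_halfK.
rewrite nE; set k := n./2%:R in h k0 *.
have kq : 0 <= k * q by rewrite mulr_ge0 // ltW.
have : (k * q) ^+ 2 <= p ^+ 2 by rewrite lerXn2r ?nnegrE //; lra.
by rewrite exprMn; nra.
Qed.

Theorem theorem1 (R : realType) (n : nat) (hn : (4 <= n)%N) (hev : ~~ odd n)
  (e : rel 'I_n) (e_irr : irreflexive e) (e_sym : symmetric e)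
  (kB T : R) (hkB : 0 < kB) (hT : 0 < T)
  (eps delta : R) (heps0 : 0 < eps) (heps1 : eps < 1)
  (hdelta0 : 0 < delta) (hdelta1 : delta < 1)
  (N : nat) (hN : N%:Z = Num.ceil (2 / eps ^+ 2 * ln (2 / delta))) :
  let beta := 1 / (kB * T) in
  let rho := thermal_state e kB T in
  let S := S_ell R e (@ell_half n) in
  let B := n%:R * expR (- (4 * beta)) / (2 * (1 + expR (- (2 * beta))) ^+ n) in
  [/\ 1 - delta <= event_prob rho S
        (fun o : {ffun 'I_N -> bool} => `|fidelity e rho - Fest R o| <= B + eps),
      B + eps <= 2 / n%:R + eps
    & (fun M : nat => event_prob rho S
        (fun o : {ffun 'I_M -> bool} => Fest R o <= fidelity e rho)) @ \oo --> (1 : R)].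
Proof.
move=> beta rho S B.
pose q : R := expR (- (2 * beta)).
have q01 : 0 < q < 1.
  by rewrite expR_gt0 expR_lt1 oppr_lt0 mulr_gt0 // divr_gt0 // mulr_gt0.
have BE : B = n%:R * q ^+ 2 / (2 * (1 + q) ^+ n).
  by rewrite /B -[q ^+ 2]expRM_natl; congr (_ * expR _ / _); ring.
pose m := (1 - q ^+ 2) ^+ n./2 / (1 + q) ^+ n.
have bornE c : born rho S c = (1 + m * outcome R c) / 2 by exact: born_thermal_state.
have FE : fidelity e rho = ((1 + q) ^+ n)^-1 by exact: fidelity_thermal_state.
have [m01 gap_gt0 gap_le] := @gap_bounds R n q hn hev q01.
rewrite -/m -FE -BE in m01 gap_gt0 gap_le.
have hm : -1 <= m <= 1 by lra.
split.
- rewrite (event_probC bornE) lerB //.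
  (* The sign s = 1 or -1 selects the upper or lower tail around [m]. As the fidelity exceeds [m] by
     at most [B], an error above [B + eps] forces a deviation from [m] above [eps]; each tail gets
     delta/2. *)
  pose Q (s : R) : pred {ffun 'I_N -> bool} := fun o => eps < s * (Fest R o - m).
  apply: le_trans (event_prob_subadd hm bornE (Q1 := Q 1) (Q2 := Q (-1)) _) _.
    move=> o /=; rewrite -ltNge lter_normr /Q.
    by case/orP=> h; apply/orP; [right | left]; lra.
  have tail s : s ^+ 2 = 1 -> event_prob rho S (Q s) <= delta / 2.
    move=> s2; apply: le_trans (event_prob_tail hm bornE (l := s * eps) _) _.
      move=> o; rewrite /Q => h; rewrite exprMn s2 mul1r mulrAC mulrC expr2.
      by rewrite ler_pM2l // ltW.
    rewrite exprMn s2 mul1r.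
    have -> : delta / 2 = expR (- ln (2 / delta)).
      by rewrite expRN lnK ?posrE ?divr_gt0 // invf_div.
    rewrite ler_expR lerN2.
    (* The choice of [N] amounts to N eps^2 / 2 >= ln(2/delta). *)
    have : 2 / eps ^+ 2 * ln (2 / delta) <= N%:R.
      by have := ceil_ge (2 / eps ^+ 2 * ln (2 / delta)); rewrite -hN.
    rewrite mulrAC ler_pdivrMr ?exprn_gt0 //; lra.
  by rewrite [leRHS]splitr lerD // tail //; lra.
- by rewrite lerD2r BE bound_le //; [exact: leq_trans hn | lra].
- set eta := fidelity e rho - m in gap_gt0.
  (* Overestimating the fidelity means exceeding the mean [m] by more than [eta]. The tail bound
     exp(-M eta^2/2) is written as an M-th power of a number below 1, so the lower envelope tends to
     1. *)
  apply: (@squeeze_cvgr _ _ _ _ (fun M => 1 - expR (- (eta ^+ 2 / 2)) ^+ M) (cst 1)).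
  + apply: nearW => M; apply/andP; split; rewrite (event_probC bornE).
      rewrite lerB // -expRM_natl mulrN; apply: (event_prob_tail hm bornE) => o /=.
      by rewrite -ltNge expr2 ler_pM2l // => h; rewrite lerB // ltW.
    by rewrite gerBl (event_prob_ge0 hm bornE).
  + rewrite -[X in _ --> X]subr0; apply: cvgB; first exact: cvg_cst.
    apply: cvg_expr; rewrite ger0_norm ?expR_ge0 // expR_lt1 oppr_lt0.
    by rewrite divr_gt0 ?exprn_gt0.
  + exact: cvg_cst.
Qed.
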